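(* Let $N$ be a distributive nearring with unity, $P$ an ideal of $N$ such that $N$ is $P$-regular, $n\geq 1$ an integer, and $B_1,\dots,B_n$ bi-ideals of $N$. If $b\in\bigcap_{i=1}^{n}B_i$ and $x\in N$, then there exist $p\in P$, $x_1,x_2,\ldots,x_{n-1}\in N$ and $b_i\in B_i$ for all $1\leq i\leq n$ such that $$b=p+b_1x_1b_2x_2\ldots b_{n-1}x_{n-1}b_n\quad\text{and}\quad b_1x_1b_2x_2\ldots b_{n-1}x_{n-1}b_n\,xP\subseteq P.$$
   Context: A nearring is a nonempty set $N$ with two binary operations, addition and multiplication, such that $(N,+)$ is a group (not assumed commutative), $(N,\cdot)$ is a semigroup, and $(a+b)c=ac+bc$ for all $a,b,c\in N$. It has a unity if it has a multiplicative identity. It is a distributive nearring if moreover $a(b+c)=ab+ac$ for all $a,b,c\in N$. For nonempty subsets $A,B\subseteq N$, $AB:=\{ab\mid a\in A,\ b\in B\}$ (no additive closure is taken), and $aB:=\{a\}B$. An ideal of $N$ is a nonempty subset $S\subseteq N$ such that (1) $S$ is a normal subgroup of $(N,+)$; (2) $SN\subseteq S$; (3) $NS\subseteq S$; (4) $n_1(n_2+s)-n_1n_2\in S$ for all $s\in S$, $n_1,n_2\in N$. A bi-ideal of $N$ is a nonempty subset $B\subseteq N$ such that $B$ is a subgroup of $(N,+)$ and $BNB\subseteq B$. Let $N$ be a nearring with unity and $P$ an ideal of $N$. $N$ is $P$-regular if for each $x\in N$ there exists $y\in N$ such that $xyx-x\in P$. *)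

(* Defs.v *)
From HB Require Import structures.
From mathcomp Require Import all_boot.
From mathcomp Require Import boolp classical_sets.

Set Implicit Arguments.
Unset Strict Implicit.
Unset Printing Implicit Defensive.

(* Sums are written in [ring_scope] and products in [group_scope]. *)
Local Open Scope classical_set_scope.
Local Open Scope ring_scope.
Local Open Scope group_scope.

(* [Algebra.ChoiceBaseAddUMagma] only provides + and 0 without any law; in
   particular, addition is not assumed to be commutative. The opposite is a field of its
   own because [Algebra.BaseZmodule] cannot be combined with a choice structure
   without going through the commutative [zmodType]. *)
HB.mixin Record isNearring N of Algebra.ChoiceBaseAddUMagma N & Semigroup N := {
  nr_opp : N -> N;
  nr_addA : associative (+%R : N -> N -> N);
  nr_add0 : left_id (0 : N) +%R;
  nr_addr0 : right_id (0 : N) +%R;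
  nr_addN : left_inverse (0 : N) nr_opp +%R;
  nr_addrN : right_inverse (0 : N) nr_opp +%R;
  nr_mulDl : left_distributive ( *%g : N -> N -> N) +%R
}.

#[short(type="nearringType")]
HB.structure Definition Nearring :=
  {N of isNearring N & Algebra.ChoiceBaseAddUMagma N & Semigroup N}.

Declare Scope nearring_scope.
Delimit Scope nearring_scope with NR.
Notation "- x" := (nr_opp x) : nearring_scope.
Notation "x - y" := (Algebra.add x (nr_opp y)) : nearring_scope.
Local Open Scope nearring_scope.

#[short(type="unitalNearringType")]
HB.structure Definition UnitalNearring := {N of Nearring N & Monoid N}.

Definition distributive_nearring (N : nearringType) : Prop :=
  forall a b c : N, a * (b + c) = a * b + a * c.

Section Subsets.
Variable N : nearringType.
Implicit Types A B S : set N.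

Definition mulset A B : set N := [set a * b | a in A & b in B].

Definition add_subgroup S : Prop :=
  [/\ S 0, forall a b : N, S a -> S b -> S (a + b) & forall a : N, S a -> S (- a)].

Definition add_normal_subgroup S : Prop :=
  add_subgroup S /\ forall n s : N, S s -> S (n + s - n).

Definition is_ideal S : Prop :=
  [/\ add_normal_subgroup S,
      mulset S setT `<=` S,
      mulset setT S `<=` S &
      forall s n1 n2 : N, S s -> S (n1 * (n2 + s) - n1 * n2)].

Definition is_bi_ideal B : Prop :=
  add_subgroup B /\ mulset (mulset B setT) B `<=` B.

End Subsets.

Definition is_regular_mod (N : unitalNearringType) (P : set N) : Prop :=
  forall x : N, exists y : N, P (x * y * x - x).

(* b_1 x_1 b_2 x_2 ... b_(n-1) x_(n-1) b_n; only the indices 1 <= i <= n of b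
   and 1 <= i < n of x are used. *)
Definition alternating_prod (N : unitalNearringType) (n : nat)
    (b x : nat -> N) : N :=
  (\prod_(1 <= i < n) (b i * x i)) * b n.

(* Main.v *)
(* If b y b = b modulo P, then (b y)^(n-1) b = b modulo P for every n >= 1, so
   every b_i can be taken to be b and every x_i to be y; the inclusion holds
   because P absorbs products on the left. *)

Require Import Defs.
From HB Require Import structures.
From mathcomp Require Import all_boot.
From mathcomp Require Import boolp classical_sets.

Set Implicit Arguments.
Unset Strict Implicit.
Unset Printing Implicit Defensive.

Local Open Scope classical_set_scope.
Local Open Scope ring_scope.
Local Open Scope group_scope.

Lemma nr_subrK (N : nearringType) (a b : N) : (a - b)%NR + b = a.
Proof. by rewrite -nr_addA nr_addN nr_addr0. Qed.

Lemma nr_subNK (N : nearringType) (a b : N) : (- (a - b))%NR + a = b.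
Proof. by rewrite -{2}(nr_subrK a b) nr_addA nr_addN nr_add0. Qed.

Lemma alternating_prodS (N : unitalNearringType) (n : nat) (b x : nat -> N) :
  (1 <= n)%N ->
  alternating_prod n.+1 b x = alternating_prod n b x * x n * b n.+1.
Proof.
by move=> n_gt0; rewrite /alternating_prod big_nat_recr //= !mulgA.
Qed.

(** Induction on [n]: lengthening the product multiplies it on the right by [y * b], which keeps [P]
    inside [P] and fixes [b] modulo [P]. *)
Lemma alternating_prod_const_mod (N : unitalNearringType) (P : set N)
    (b y : N) (n : nat) :
  is_ideal P -> P (b * y * b - b)%NR -> (1 <= n)%N ->
  P (alternating_prod n (fun=> b) (fun=> y) - b)%NR.
Proof.
move=> [[[P0 PD _] _] PM _ _] Pbyb; elim: n => // -[_ _|n IHn _].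
  (* For [n = 1] the indexed product is empty, leaving [b] alone. *)
  by rewrite /alternating_prod big_geq // mul1g nr_addrN.
rewrite alternating_prodS //.
set a := alternating_prod _ _ _ in IHn *.
(* With [a = (a - b) + b], right distributivity gives [a * y * b - b = (a - b) * y * b + (b * y * b
   - b)], without reordering any summands. *)
rewrite -(nr_subrK a b) 2!nr_mulDl -nr_addA; apply: PD => //.
rewrite -mulgA; apply: PM; exists (a - b)%NR; first exact: IHn.
by exists (y * b).
Qed.

Theorem theorem3p5 (N : unitalNearringType) (hN : distributive_nearring N)
    (P : set N) (hP : is_ideal P) (hreg : is_regular_mod P)
    (n : nat) (hn : (1 <= n)%N)
    (B : nat -> set N) (hB : forall i, (1 <= i <= n)%N -> is_bi_ideal (B i))
    (b x : N) (hb : (\bigcap_(i in [set i | (1 <= i <= n)%N]) B i) b) :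
  exists (p : N) (xs bs : nat -> N),
    [/\ P p,
        forall i, (1 <= i <= n)%N -> B i (bs i),
        b = p + alternating_prod n bs xs &
        mulset [set alternating_prod n bs xs * x] P `<=` P].
Proof.
have [y Pbyb] := hreg b.
have [[[_ _ PN] _] _ MP _] := hP.
have Pab := alternating_prod_const_mod hP Pbyb hn.
(* This is [b] minus the product, written as an opposite so that closure of [P] under opposites
   applies. *)
exists (- (alternating_prod n (fun=> b) (fun=> y) - b))%NR.
exists (fun=> y), (fun=> b); split.
- exact: PN.
- by move=> i; apply: hb.
- by rewrite nr_subNK.
- by move=> _ [c _ [q Pq <-]]; apply: MP; exists c => //; exists q.
Qed.
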